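(* Let $Z$ be the Riemann species, i.e. the species such that $Z(S)$ is the set of ways of making the finite set $S$ into a semisimple commutative ring (equivalently, $Z={\prod_{p\in\mathbb{P}}}^D\exp_D(F_p)$). Then its Dirichlet series is the Riemann zeta function: $\widehat{Z}(s)=\sum_{n\ge1}n^{-s}$ as formal Dirichlet series; equivalently, for every $n\ge1$ there are exactly $n!$ ways to make an $n$-element set into a semisimple commutative ring.
   Context: A species is a functor from the groupoid of finite sets and bijections to $\mathbf{Set}$. A ''way of making $S$ into a semisimple commutative ring'' is a choice of addition and multiplication on $S$ making it a semisimple commutative ring (for finite rings: a finite product of finite fields, the one-element ring being the empty product). For a species $F$ with finite values, $\widehat{F}(s)=\sum_{n\ge1}\frac{|F(n)|}{n!}n^{-s}$, with $F(n)$ the value on an $n$-element set. In the paper, $F_p$ is the species of field structures of characteristic $p$, $\exp_D$ the Dirichlet exponential and ${\prod}^D$ the Euler product of species (built from the Dirichlet product, in which a structure on $S$ is a decomposition of $S$ as a cartesian product of two sets with a structure on each factor); the resulting species is the species of semisimple commutative ring structures. *)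

(* Defs.v *)
From HB Require Import structures.
From mathcomp Require Import all_boot all_order all_algebra all_field.
From mathcomp Require Import boolp.
Set Implicit Arguments. Unset Strict Implicit. Unset Printing Implicit Defensive.
Import GRing.Theory.

Definition binop (n : nat) : finType := {ffun 'I_n -> {ffun 'I_n -> 'I_n}}.
Definition ring_data (n : nat) : finType := (binop n * binop n)%type.

Definition is_com_ring (T : Type) (add mul : T -> T -> T) : Prop :=
  exists (zero one : T) (opp : T -> T),
    [/\ (forall x y z, add x (add y z) = add (add x y) z),
        (forall x y, add x y = add y x),
        (forall x, add zero x = x) &
        (forall x, add (opp x) x = zero)] /\
    [/\ (forall x y z, mul x (mul y z) = mul (mul x y) z),
        (forall x y, mul x y = mul y x),
        (forall x, mul one x = x) &
        (forall x y z, mul x (add y z) = add (mul x y) (mul x z))].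

(* (S, add, mul) is isomorphic (bijection preserving + and * ) to a finite
   product of finite fields \prod_{i<k} F_i (k = 0 gives the one-element ring). *)
Definition iso_prod_finfields (T : Type) (add mul : T -> T -> T) : Prop :=
  exists (k : nat) (F : 'I_k -> finFieldType) (phi : T -> forall i, F i),
    [/\ bijective phi,
        (forall x y, phi (add x y) = fun i => (phi x i + phi y i)%R) &
        (forall x y, phi (mul x y) = fun i => (phi x i * phi y i)%R)].

Definition is_ss_com_ring_structure (n : nat) (d : ring_data n) : Prop :=
  let add := fun x y : 'I_n => d.1 x y in
  let mul := fun x y : 'I_n => d.2 x y in
  is_com_ring add mul /\ iso_prod_finfields add mul.

Definition riemann_species (n : nat) : {set ring_data n} :=
  [set d | `[< is_ss_com_ring_structure d >] ].

(* Main.v *)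
Require Import Defs.
From HB Require Import structures.
From mathcomp Require Import all_boot all_algebra all_fingroup all_solvable.
From mathcomp Require Import all_field boolp.
Set Implicit Arguments. Unset Strict Implicit.
Unset Printing Implicit Defensive.
Import GRing.Theory.

(* Let N(n) be the number of structures, p a prime divisor of n, v the p-adic
   valuation of n, and K_j a field with p^j elements. A surjective homomorphism
   from a product of fields onto K_j factors through exactly one factor, which is
   then isomorphic to K_j, and there are j isomorphisms between two fields with
   p^j elements. So each structure on n points has exactly v surjective
   homomorphisms onto the fields K_1, ..., K_v. On the other hand, pulling back
   K_j x R along a bijection from an n-set to K_j x 'I_m, m = n / p^j, gives a
   structure with a surjection x onto K_j, and every such pair is obtained m!
   times: a complement of x is unique, so only the labelling of R by 'I_m varies.
   By induction N(m) = m!, so that there are n! N(m) / m! = n! such pairs for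
   each j; summing over j gives N(n) v = v n!. *)

(** * Surjective homomorphisms between finite fields *)

Definition ring_hom (T U : Type) (addT mulT : T -> T -> T)
    (addU mulU : U -> U -> U) (f : T -> U) : Prop :=
  {morph f : x y / addT x y >-> addU x y} /\
  {morph f : x y / mulT x y >-> mulU x y}.

(** Surjectivity takes the place of unitality: onto a field it forces a unit to go to 1, and it
    excludes the zero map. *)
Definition surj_homs (T : finType) (add mul : T -> T -> T) (K : finFieldType) :
    {set {ffun T -> K}} :=
  [set f : {ffun T -> K} |
    `[< ring_hom add mul +%R *%R f /\ forall y, exists x, f x = y >] ].

Section FieldHoms.
Local Open Scope ring_scope.

Lemma surj_homP (T : finType) (add mul : T -> T -> T) (K : finFieldType)
    (f : {ffun T -> K}) :
  reflect (ring_hom add mul +%R *%R f /\ forall y, exists x, f x = y)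
          (f \in surj_homs add mul K).
Proof. by rewrite inE; apply: asboolP. Qed.

(** The embedding of the prime field. The proof [cF] is an argument so that the morphism instances
    below can be attached to [Fp_inj cF]. *)
Definition Fp_inj (p : nat) (F : finFieldType) (cF : p \in [pchar F])
    (c : 'F_p) : F :=
  (c : nat)%:R.

Fact Fp_inj_zmod_morphism p (F : finFieldType) (cF : p \in [pchar F]) :
  zmod_morphism (Fp_inj cF).
Proof.
(* In the algebra [pPrimeCharType cF] over ['F_p], the scalar [c] acts as multiplication by [c%:R],
   so [in_alg] is the map in question. *)
move=> a b; have := rmorphB (in_alg (pPrimeCharType cF)) a b.
by rewrite /= /GRing.scale /= /pprimeChar_scale !mulr1.
Qed.

Fact Fp_inj_monoid_morphism p (F : finFieldType) (cF : p \in [pchar F]) :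
  monoid_morphism (Fp_inj cF).
Proof.
have pr_p := pcharf_prime cF.
split=> [|a b]; first by rewrite /Fp_inj /= Fp_cast // modn_small ?prime_gt1.
have := rmorphM (in_alg (pPrimeCharType cF)) a b.
by rewrite /= /GRing.scale /= /pprimeChar_scale !mulr1.
Qed.

HB.instance Definition _ p F cF :=
  GRing.isZmodMorphism.Build _ _ _ (@Fp_inj_zmod_morphism p F cF).
HB.instance Definition _ p F cF :=
  GRing.isMonoidMorphism.Build _ _ _ (@Fp_inj_monoid_morphism p F cF).

Lemma surj_hom_fieldE (F K : finFieldType) (f : {ffun F -> K}) :
  f \in surj_homs +%R *%R K ->
  exists h : {rmorphism F -> K}, f =1 h.
Proof.
case/surj_homP=> -[fD fM] fS.
have f0 : f 0 = 0 by apply: (addrI (f 0)); rewrite -fD !addr0.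
have f1 : f 1 = 1.
  by have [x fx] := fS 1; rewrite -[LHS]mulr1 -fx -fM mul1r.
have fB : {morph f : x y / x - y}.
  move=> x y; apply: (addIr (f y)); by rewrite -fD !subrK.
pose hA := GRing.isZmodMorphism.Build F K f fB.
pose hM := GRing.isMonoidMorphism.Build F K f (conj f1 fM).
pose h : {rmorphism F -> K} := HB.pack (fun_of_fin f) hA hM.
by exists h.
Qed.

Lemma field_generator (F : finFieldType) :
  exists g : F, forall x : F, x != 0 -> exists i, x = g ^+ i.
Proof.
have /cyclicP[g gE] := field_unit_group_cyclic [set: {unit F}]%G.
exists (val g) => x x0.
have : finField_unit x0 \in <[g]>%g by rewrite -gE inE.
by case/cycleP=> i /(congr1 val) /= xE; exists i; rewrite xE FinRing.val_unitX.
Qed.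

(* Let g generate the multiplicative group of F and let f be its minimal
   polynomial over 'F_p, of degree k. A homomorphism F -> K amounts to a root of
   f in K, and f splits in K into distinct factors since it divides 'X^#|F| - 'X. *)
Lemma card_surj_homs_field p k (F K : finFieldType) : prime p ->
  #|F| = (p ^ k)%N -> #|K| = (p ^ k)%N ->
  #|surj_homs (+%R : F -> F -> F) *%R K| = k.
Proof.
move=> pr_p oF oK.
have cF := card_finPcharP oF pr_p; have cK := card_finPcharP oK pr_p.
pose evF r (P : {poly 'F_p}) := (map_poly (Fp_inj cF) P).[r].
pose evK r (P : {poly 'F_p}) := (map_poly (Fp_inj cK) P).[r].
have [g gP] := field_generator F.
pose X : {poly 'F_p} := 'X^#|F| - 'X.
have XF : map_poly (Fp_inj cF) X = 'X^#|F| - 'X.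
  by rewrite rmorphB /= map_polyXn map_polyX.
have XK : map_poly (Fp_inj cK) X = 'X^#|K| - 'X.
  by rewrite rmorphB /= map_polyXn map_polyX oF oK.
have gX : evF g X = 0 by rewrite /evF XF !hornerE expf_card subrr.
have X0 : X != 0.
  by rewrite -(map_poly_eq0 (Fp_inj cF)) XF finField_genPoly prodf_seq_neq0;
     apply/allP=> x _; rewrite polyXsubC_eq0.
have exd : exists d, `[< exists P : {poly 'F_p},
    [/\ size P = d, P != 0 & evF g P = 0] >].
  by exists (size X); apply/asboolP; exists X.
(* [f] is a minimal polynomial of [g], not necessarily monic; [d] is its size, one more than its
   degree. *)
have [d /asboolP[f [df f0 gf]] dmin] := ex_minnP exd.
have evF_mod (P : {poly 'F_p}) : evF g (P %% f) = evF g P.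
  rewrite [in RHS](divp_eq P f) /evF rmorphD rmorphM /= hornerD hornerM.
  by rewrite -![(map_poly _ _).[_]]/(evF _ _) gf mulr0 add0r.
have fmin P : evF g P = 0 -> f %| P.
  move=> gP0; rewrite /dvdp; apply/negPn/negP=> r0.
  have: (d <= size (P %% f)%R)%N.
    apply: dmin; apply/asboolP; exists (P %% f); split=> //.
    by rewrite evF_mod.
  by apply/negP; rewrite -df leqNgt ltn_modp f0.
have evFD x : {morph evF x : P Q / P - Q}.
  by move=> P Q; rewrite /evF rmorphB hornerD hornerN.
(* Every nonzero element is a power of [g], hence the value at [g] of a polynomial that can be
   reduced modulo [f]. *)
have lift_F x : exists P : {poly 'F_p}, (size P < d)%N /\ evF g P = x.
  have [->|/gP[i ->]] := eqVneq x 0.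
    exists 0; rewrite size_poly0 -df lt0n size_poly_eq0 f0; split=> //.
    by rewrite /evF rmorph0 horner0.
  exists ('X^i %% f); rewrite -df ltn_modp f0; split=> //.
  by rewrite evF_mod /evF map_polyXn hornerXn.
have d_gt0 : (0 < d)%N by rewrite -df lt0n size_poly_eq0.
(* Evaluation at [g] is a bijection from the polynomials of size at most [d.-1] onto [F]; comparing
   cardinals gives the degree of [f]. *)
have dk : d.-1 = k.
  pose h (v : 'rV['F_p]_d.-1) := evF g (rVpoly v).
  have hI : injective h.
    move=> v w vw; apply: (can_inj rVpolyK); apply/eqP; rewrite -subr_eq0.
    apply/negPn/negP=> nz; have := fmin (rVpoly v - rVpoly w).
    rewrite evFD -!/(h _) vw subrr => /(_ erefl)/(dvdp_leq nz).
    have le_d : (size (rVpoly v - rVpoly w)%R <= d.-1)%N.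
      by rewrite -linearB size_poly.
    by rewrite df => /leq_trans/(_ le_d); rewrite leqNgt ltn_predL d_gt0.
  have hb : bijective h.
    apply: inj_card_bij => //; rewrite -[leqRHS](card_codom hI).
    apply/subset_leq_card/subsetP=> x _.
    have [P [sP <-]] := lift_F x; apply/codomP; exists (poly_rV P).
    by rewrite /h poly_rV_K // -ltnS prednK.
  have := bij_eq_card hb; rewrite card_mx mul1n card_Fp // oF => /eqP.
  by rewrite eqn_exp2l ?prime_gt1 // => /eqP.
pose fK := map_poly (Fp_inj cK) f.
(* The list [s] of the roots of [fK] in [K] is without repetition and has as many elements as the
   degree of [f]. *)
have : fK %| \prod_(x : K) ('X - x%:P).
  by rewrite -finField_genPoly -XK dvdp_map fmin.
rewrite -big_enum => /dvdp_prod_XsubC[m]; set s := mask m _ => fKs.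
have us : uniq s by rewrite mask_uniq // enum_uniq.
have ss : size s = k.
  have := eqp_size fKs; rewrite size_map_poly df.
  by rewrite size_prod_XsubC -dk => ->.
have rs r : (r \in s) = (evK r f == 0).
  by rewrite -[_ == 0]/(root fK r) (eqp_root fKs) root_prod_XsubC.
have homE (h : {rmorphism F -> K}) P : h (evF g P) = evK (h g) P.
  rewrite /evF /evK -horner_map -map_poly_comp; congr (_.[_]).
  by apply: eq_map_poly => c; exact: rmorph_nat.
rewrite -ss -(card_uniqP us).
(* Evaluation at [g] maps the homomorphisms onto the roots of [fK]; injectivity, proved last, holds
   because [g] generates [F] over the prime field. *)
rewrite -(card_in_imset (f := fun x : {ffun F -> K} => x g)).
  apply: eq_card => r; rewrite rs; apply/imsetP/eqP.
    move=> [x /surj_hom_fieldE[h xh] ->]; rewrite xh -homE.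
    by rewrite gf rmorph0.
  move=> rf.
  (* For a root [r], the value of a polynomial at [r] depends only on its value at [g]. Hence the
     choice of the lifts [L] does not affect [x] below, and [x] is a homomorphism. *)
  have evK_eq P Q : evF g P = evF g Q -> evK r P = evK r Q.
    move=> PQ; apply/eqP; rewrite -subr_eq0 /evK -hornerN -hornerD -rmorphB.
    have /dvdpP[A ->] : f %| P - Q by apply: fmin; rewrite evFD PQ subrr.
    by rewrite rmorphM hornerM [X in _ * X]rf mulr0.
  have [L LP] : exists L : F -> {poly 'F_p}, forall x, evF g (L x) = x.
    exists (fun x => projT1 (cid (lift_F x))) => x.
    by have [] := projT2 (cid (lift_F x)).
  have L1 : evK r (L 1) = 1.
    rewrite (@evK_eq _ 1) ?LP /evF /evK rmorph1 hornerE //.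
  pose x := [ffun y => evK r (L y)].
  have xD : {morph x : y z / y + z}.
    move=> y z; rewrite !ffunE /evK -hornerD -rmorphD; apply: evK_eq.
    by rewrite LP /evF rmorphD hornerD -!/(evF _ _) !LP.
  have xM : {morph x : y z / y * z}.
    move=> y z; rewrite !ffunE /evK -hornerM -rmorphM; apply: evK_eq.
    by rewrite LP /evF rmorphM hornerM -!/(evF _ _) !LP.
  have x0 : x 0 = 0 by apply: (addrI (x 0)); rewrite -xD !addr0.
  have xI : injective x.
    move=> y z yz; apply/eqP; rewrite -subr_eq0; apply/negPn/negP => nz.
    have : x (y - z) = 0 by apply: (addIr (x z)); rewrite -xD subrK add0r.
    move=> xyz; have : x 1 = 1 by rewrite ffunE.
    by rewrite -(mulfV nz) xM xyz mul0r => /esym/eqP; rewrite oner_eq0.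
  have [x' _ xx'] : bijective x by apply: inj_card_bij; rewrite // oF oK.
  have gX' : evF g (L g) = evF g 'X by rewrite LP /evF map_polyX hornerX.
  exists x; last by rewrite ffunE (evK_eq _ _ gX') /evK map_polyX hornerX.
  by apply/surj_homP; split=> // y; exists (x' y).
move=> x y xS yS xy; have [h xh] := surj_hom_fieldE xS.
have [h' yh'] := surj_hom_fieldE yS.
apply/ffunP=> z; have [P [_ <-]] := lift_F z.
by rewrite xh yh' !homE -xh -yh' xy.
Qed.
End FieldHoms.

Local Open Scope ring_scope.
Lemma surj_homs_card_neq (F K : finFieldType) : #|F| != #|K| ->
  surj_homs (+%R : F -> F -> F) *%R K = set0.
Proof.
move=> neFK; apply/setP=> f; rewrite in_set0; apply/negP=> fS.
case/surj_homP: (fS) => _ fsurj; case: (surj_hom_fieldE fS) => h fh.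
have hI : injective h by exact: fmorph_inj.
have hb : bijective h.
  apply: inj_card_bij => //; rewrite -[leqRHS](card_codom hI).
  apply/subset_leq_card/subsetP=> y _.
  by have [x <-] := fsurj y; rewrite fh codom_f.
by rewrite (bij_eq_card hb) eqxx in neFK.
Qed.

(** Only a [K k] of the same size as [F] contributes. If [F] has p^(j+1) elements this is [K j], by
    the shift in the exponent, and it contributes j+1; if p does not divide the size of [F], every
    term is zero. *)
Lemma sum_surj_homs_field p v (F : finFieldType) (K : nat -> finFieldType) :
  prime p -> (forall k, #|K k| = (p ^ k.+1)%N) -> (logn p #|F| <= v)%N ->
  (\sum_(k < v) #|surj_homs (+%R : F -> F -> F) *%R (K k)| = logn p #|F|)%N.
Proof.
move=> pr_p oK.
case E : (logn p #|F|) => [|j] jv.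
  rewrite big1 // => k _; rewrite surj_homs_card_neq ?cards0 // oK.
  by apply/eqP=> oF; rewrite oF pfactorK in E.
have oF : #|F| = (p ^ j.+1)%N.
  (* The size of [F] is a power of its characteristic [q], and p divides it, so p = q. *)
  have [q pr_q cF] := finPcharP F.
  have oF := card_pprimeChar cF; rewrite -[#|_|]/#|F| in oF.
  suff pq : p = q by rewrite -pq E in oF.
  have : p \in primes #|F| by rewrite -logn_gt0 E.
  rewrite mem_primes oF => /and3P[_ _].
  by rewrite Euclid_dvdX // => /andP[]; rewrite dvdn_prime2 // => /eqP.
rewrite (bigD1 (Ordinal jv)) //= (@card_surj_homs_field p j.+1) ?oK //.
rewrite big1 ?addn0 // => k kj; rewrite surj_homs_card_neq ?cards0 // oK oF.
rewrite eqn_exp2l ?prime_gt1 //; by rewrite -val_eqE /= eq_sym in kj.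
Qed.

(* Products of finite fields, built one factor at a time *)
Local Close Scope ring_scope.

(** An inductive form of [iso_prod_finfields], suited to induction on the number of factors. The
    carrier is any type with a bijective pair of projections, so that isomorphic copies are
    included. *)
Inductive split_ring :
  forall T : finType, (T -> T -> T) -> (T -> T -> T) -> Prop :=
| split_one (T : finType) (add mul : T -> T -> T) :
    #|T| = 1 -> @split_ring T add mul
| split_cons (F : finFieldType) (T' : finType) (add' mul' : T' -> T' -> T')
    (T : finType) (add mul : T -> T -> T)
    (f : T -> F) (g : T -> T') : @split_ring T' add' mul' ->
    ring_hom add mul +%R *%R f -> ring_hom add mul add' mul' g ->
    bijective (fun x => (f x, g x)) -> @split_ring T add mul.

Lemma is_com_ring_pair (A B T : Type) (addA mulA : A -> A -> A)
    (addB mulB : B -> B -> B) (add mul : T -> T -> T)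
    (f : T -> A) (g : T -> B) :
  is_com_ring addA mulA -> is_com_ring addB mulB ->
  ring_hom add mul addA mulA f -> ring_hom add mul addB mulB g ->
  bijective (fun x => (f x, g x)) -> is_com_ring add mul.
Proof.
move=> [z [o [n [[a1 a2 a3 a4] [m1 m2 m3 m4]]]]].
move=> [z' [o' [n' [[a1' a2' a3' a4'] [m1' m2' m3' m4']]]]].
move=> [fD fM] [gD gM] [h hK Kh].
have fh a b : f (h (a, b)) = a by have := Kh (a, b); case.
have gh a b : g (h (a, b)) = b by have := Kh (a, b); case.
have inj x y : f x = f y -> g x = g y -> x = y.
  by move=> fxy gxy; apply: (can_inj hK); rewrite /= fxy gxy.
exists (h (z, z')), (h (o, o')), (fun x => h (n (f x), n' (g x))).
by split; split=> *; apply: inj; rewrite ?(fD, fM, gD, gM, fh, gh).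
Qed.

Lemma field_is_com_ring (F : fieldType) : @is_com_ring F +%R *%R.
Proof.
exists 0%R, 1%R, GRing.opp; split; split.
- exact: addrA. - exact: addrC. - exact: add0r. - exact: addNr.
- exact: mulrA. - exact: mulrC. - exact: mul1r. - exact: mulrDr.
Qed.

Lemma split_is_com_ring (T : finType) (add mul : T -> T -> T) :
  split_ring add mul -> is_com_ring add mul.
Proof.
elim=> [{}T {}add {}mul T1|F T' add' mul' {}T {}add {}mul f g _ IH fh gh fgb].
  have /fintype1P[z zE] : #|T| == 1 by apply/eqP.
  have E (x y : T) : x = y by rewrite (zE x) (zE y).
  by exists z, z, id; split; split=> *; apply: E.
exact: is_com_ring_pair (field_is_com_ring F) IH fh gh fgb.
Qed.

Lemma split_ring_iso (T U : finType) (addT mulT : T -> T -> T)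
    (addU mulU : U -> U -> U) (h : U -> T) :
  bijective h -> ring_hom addU mulU addT mulT h ->
  split_ring addT mulT -> split_ring addU mulU.
Proof.
move=> hb hh sT; case: sT h hb hh => [{}T {}addT {}mulT T1 h hb _|].
  by apply: split_one; rewrite (bij_eq_card hb).
move=> F T' add' mul' {}T {}addT {}mulT f g sT' [fD fM] [gD gM] fgb.
move=> h hb [hD hM].
apply: (split_cons (f := f \o h) (g := g \o h) sT').
- by split=> x y /=; rewrite ?hD ?hM ?fD ?fM.
- by split=> x y /=; rewrite ?hD ?hM ?gD ?gM.
- exact: bij_comp fgb hb.
Qed.

Lemma bij_reindex (I J : Type) (r : J -> I) (D : I -> Type) :
  bijective r ->
  bijective (fun (x : forall i, D i) (j : J) => x (r j)).
Proof.
move=> [s rK sK].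
(* The value of [y] at [s i] lives in [D (r (s i))] and is transported to [D i] along [sK i]. *)
exists (fun (y : forall j, D (r j)) i => ecast i (D i) (sK i) (y (s i))).
  move=> x; apply: functional_extensionality_dep => i.
  by move: (s i) (sK i) => j; case: i /.
move=> y; apply: functional_extensionality_dep => j.
move: (sK (r j)); rewrite rK => e.
by rewrite (Prop_irrelevance e erefl).
Qed.

(** Splits one factor off a dependent product; [lift0_opt] carries this over to families indexed by
    ['I_k.+1]. *)
Lemma bij_option_fun (J : Type) (E : option J -> Type) :
  bijective (fun x : forall o, E o => (x None, fun j => x (Some j))).
Proof.
exists (fun y o => match o return E o with None => y.1 | Some j => y.2 j end).
  by move=> x; apply: functional_extensionality_dep; case.
by case.
Qed.

Definition lift0_opt k (o : option 'I_k) : 'I_k.+1 :=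
  if o is Some j then lift ord0 j else ord0.

Lemma lift0_optK k : cancel (@lift0_opt k) (unlift ord0).
Proof. by case=> [j|]; rewrite ?liftK ?unlift_none. Qed.

Lemma unlift0K k : cancel (unlift ord0) (@lift0_opt k).
Proof. by move=> i; case: (unliftP ord0 i) => [j|] ->. Qed.

(** The carriers in [split_ring] are of type [finType], so the product of the remaining factors is
    represented by finite functions. *)
Lemma bij_finfun (J : finType) (E : J -> finType) :
  bijective (fun x : forall j, E j => [ffun j => x j] : {dffun forall j, E j}).
Proof.
exists (fun (y : {dffun forall j, E j}) j => y j).
  by move=> x; apply: functional_extensionality_dep => j; rewrite ffunE.
by move=> y; apply/ffunP=> j; rewrite ffunE.
Qed.

Lemma iso_prod_split (T : finType) (add mul : T -> T -> T) :
  iso_prod_finfields add mul -> split_ring add mul.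
Proof.
case=> k; elim: k T add mul => [|k IHk] T add mul [F [phi [phib phiD phiM]]].
  apply: split_one.
  have /bij_eq_card -> : bijective (fun _ : T => tt); last by rewrite card_unit.
  case: phib => psi phiK psiK.
  exists (fun=> psi (fun i => False_rect _ (notF (ltn_ord i)))).
    move=> x; rewrite -[RHS]phiK; congr psi.
    by apply: functional_extensionality_dep; case.
  by case.
pose F' j := F (lift ord0 j).
pose T' : finType := {dffun forall j : 'I_k, F' j}.
(* Componentwise operations, with the operation as a parameter to cover both addition and
   multiplication. *)
pose ops (op : forall R : finFieldType, R -> R -> R) (x y : T') : T' :=
  [ffun j => op (F' j) (x j) (y j)].
pose g x : T' := [ffun j => phi x (lift ord0 j)].
have sT' : split_ring (ops (fun R => +%R)) (ops (fun R => *%R)).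
  apply: IHk; exists F', (fun (x : T') j => x j); split=> [|x y|x y].
  - exists (fun x => [ffun j => x j] : T').
      by move=> y; apply/ffunP=> j; rewrite ffunE.
    by move=> x; apply: functional_extensionality_dep => j; rewrite ffunE.
  - by apply: functional_extensionality_dep => j; rewrite ffunE.
  - by apply: functional_extensionality_dep => j; rewrite ffunE.
apply: (split_cons (f := fun x => phi x ord0) (g := g) sT').
- by split=> x y; rewrite ?phiD ?phiM.
- by split=> x y; apply/ffunP=> j; rewrite !ffunE ?phiD ?phiM.
have lift0_bij := Bijective (@lift0_optK k) (@unlift0K k).
have b1 := bij_comp (bij_reindex F lift0_bij) phib.
have b2 := bij_comp (bij_option_fun _) b1.
have [h hK Kh] := b2; have [e eK Ke] := bij_finfun F'.
exists (fun u => h (u.1, e u.2)).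
  by move=> x /=; rewrite -[RHS]hK; congr (h (_, _)); apply: eK.
move=> [a y] /=; have := Kh (a, e y); case => /= -> ye.
by congr (_, _); rewrite -[RHS]Ke -[in RHS]ye.
Qed.

Lemma split_iso_prod (T : finType) (add mul : T -> T -> T) :
  split_ring add mul -> iso_prod_finfields add mul.
Proof.
elim=> [{}T {}add {}mul T1|F T' add' mul' {}T {}add {}mul f g _].
  have /fintype1P[z zE] : #|T| == 1 by apply/eqP.
  exists 0, (fun i : 'I_0 => False_rect finFieldType (notF (ltn_ord i))).
  exists (fun _ (i : 'I_0) => False_rect _ (notF (ltn_ord i))).
  split; try by move=> x y; apply: functional_extensionality_dep; case.
  exists (fun=> z); first by move=> x.
  by move=> y; apply: functional_extensionality_dep; case.
case=> k [G [phi [phib phiD phiM]]] [fD fM] [gD gM] fgb.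
pose E (o : option 'I_k) := if o is Some j then G j else F.
pose ext x (o : option 'I_k) : E o :=
  match o return E o with None => f x | Some j => phi (g x) j end.
exists k.+1, (fun i => E (unlift ord0 i)), (fun x i => ext x (unlift ord0 i)).
split.
- apply: bij_comp (bij_reindex E (Bijective (@unlift0K k) (@lift0_optK k))) _.
  have [h hK Kh] := fgb; have [psi phiK psiK] := phib.
  exists (fun y : forall o, E o => h (y None, psi (fun j => y (Some j)))).
    by move=> x /=; rewrite phiK hK.
  move=> y; apply: functional_extensionality_dep => o.
  have [e1 e2] := Kh (y None, psi (fun j => y (Some j))).
  by case: o => [j|] /=; rewrite ?e1 // e2 psiK.
- move=> x y; apply: functional_extensionality_dep => i.
  by case: (unlift ord0 i) => [j|] /=; rewrite ?fD // gD phiD.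
- move=> x y; apply: functional_extensionality_dep => i.
  by case: (unlift ord0 i) => [j|] /=; rewrite ?fM // gM phiM.
Qed.

Lemma riemann_speciesP n (d : ring_data n) :
  reflect (split_ring (fun x y => d.1 x y) (fun x y => d.2 x y))
          (d \in riemann_species n).
Proof.
rewrite inE; apply: (iffP (asboolP _)) => [[_ /iso_prod_split]|s] //.
by split; [apply: split_is_com_ring | apply: split_iso_prod].
Qed.

(** * Homomorphisms from a product of two rings to a field *)

Lemma com_ring_zero_one (T : Type) (add mul : T -> T -> T) :
  is_com_ring add mul ->
  exists z o, [/\ left_id z add, right_id z add, left_id o mul, right_id o mul
                & left_zero z mul /\ right_zero z mul].
Proof.
case=> z [o [n [[aA aC a0 aN] [mA mC m1 mD]]]].
have a0r x : add x z = x by rewrite aC a0.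
have m0 x : mul x z = z.
  have e : add (mul x z) (mul x z) = mul x z by rewrite -mD a0.
  by have := aA (n (mul x z)) (mul x z) (mul x z); rewrite e aN a0.
by exists z, o; split=> //; [|split=> //] => x; rewrite mC.
Qed.

Lemma ring_hom_zero (T : Type) (add mul : T -> T -> T) (K : fieldType)
    (f : T -> K) z :
  ring_hom add mul +%R *%R f -> left_id z add -> f z = 0%R.
Proof. by case=> fD _ a0; apply: (addrI (f z)); rewrite -fD a0 addr0. Qed.

Section PairHoms.
Variables (A B T : finType) (addA mulA : A -> A -> A) (addB mulB : B -> B -> B).
Variables (add mul : T -> T -> T) (f : T -> A) (g : T -> B).
Hypotheses (crA : is_com_ring addA mulA) (crB : is_com_ring addB mulB).
Hypothesis fh : ring_hom add mul addA mulA f.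
Hypothesis gh : ring_hom add mul addB mulB g.
Hypothesis fgb : bijective (fun x => (f x, g x)).
Variable K : finFieldType.
Local Open Scope ring_scope.

Let pull_f (u : {ffun A -> K}) : {ffun T -> K} := [ffun x => u (f x)].
Let pull_g (u : {ffun B -> K}) : {ffun T -> K} := [ffun x => u (g x)].

(** Let e = (1, 0). A homomorphism x satisfies x(a, 0) = x(a, 0) x(e) and x(0, b) x(e) = 0. In a
    field, either x(e) = 0 and x vanishes on [A], or x vanishes on [B]; so x factors through [g] or
    through [f]. *)
Lemma surj_homs_pair :
  surj_homs add mul K =
  pull_f @: surj_homs addA mulA K :|: pull_g @: surj_homs addB mulB K.
Proof.
have [z [o [a0 a0r m1 m1r [m0 m0r]]]] := com_ring_zero_one crA.
have [z' [o' [a0' a0r' m1' m1r' [m0' m0r']]]] := com_ring_zero_one crB.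
have [h hK Kh] := fgb; have [fD fM] := fh; have [gD gM] := gh.
have fE a b : f (h (a, b)) = a by have := Kh (a, b); case.
have gE a b : g (h (a, b)) = b by have := Kh (a, b); case.
have inj x y : f x = f y -> g x = g y -> x = y.
  by move=> fxy gxy; apply: (can_inj hK); rewrite /= fxy gxy.
apply/setP=> x; rewrite in_setU; apply/idP/orP; last first.
  case=> /imsetP[u /surj_homP[[uD uM] us] ->]; apply/surj_homP.
    split; first by split=> a b; rewrite !ffunE ?fD ?fM.
    by move=> y; have [a <-] := us y; exists (h (a, z')); rewrite ffunE fE.
  split; first by split=> a b; rewrite !ffunE ?gD ?gM.
  by move=> y; have [a <-] := us y; exists (h (z, a)); rewrite ffunE gE.
move=> /surj_homP[[xD xM] xs]; pose e := h (o, z').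
have x0 : x (h (z, z')) = 0.
  apply: (ring_hom_zero (conj xD xM)) => a.
  by apply: inj; rewrite ?fD ?gD ?fE ?gE ?a0 ?a0'.
have xdec a : x a = x (h (f a, z')) + x (h (z, g a)).
  rewrite -xD; congr (x _); apply: inj.
    by rewrite fD !fE a0r.
  by rewrite gD !gE a0'.
have xe a : x (h (a, z')) = x (h (a, z')) * x e.
  rewrite -xM; congr (x _); apply: inj.
    by rewrite fM !fE m1r.
  by rewrite gM !gE m0'.
have xe0 b : x (h (z, b)) * x e = 0.
  rewrite -xM -[RHS]x0; congr (x _); apply: inj.
    by rewrite fM !fE m0.
  by rewrite gM !gE m0r'.
have [e0|e1] := eqVneq (x e) 0.
  right; pose u := [ffun b => x (h (z, b))].
  have xu a : x a = u (g a) by rewrite ffunE xdec xe e0 mulr0 add0r.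
  apply/imsetP; exists u; last by apply/ffunP=> a; rewrite ffunE.
  apply/surj_homP; split; last by move=> y; have [a <-] := xs y; exists (g a).
  by split=> a b; rewrite !ffunE -?xD -?xM; congr (x _); apply: inj;
    rewrite ?fD ?fM ?gD ?gM ?fE ?gE ?a0 ?m0.
left; pose u := [ffun a => x (h (a, z'))].
have xz b : x (h (z, b)) = 0.
  by apply/eqP; have /eqP := xe0 b; rewrite mulf_eq0 (negPf e1) orbF.
have xu a : x a = u (f a) by rewrite ffunE xdec xz addr0.
apply/imsetP; exists u; last by apply/ffunP=> a; rewrite ffunE.
apply/surj_homP; split; last by move=> y; have [a <-] := xs y; exists (f a).
by split=> a b; rewrite !ffunE -?xD -?xM; congr (x _); apply: inj;
  rewrite ?fD ?fM ?gD ?gM ?fE ?gE ?a0' ?m0'.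
Qed.

(** The two families of pullbacks are disjoint: at (1, 0) those along [g] vanish, while those along
    [f] do not. *)
Lemma card_surj_homs_pair :
  #|surj_homs add mul K| =
  (#|surj_homs addA mulA K| + #|surj_homs addB mulB K|)%N.
Proof.
have [z [o [a0 a0r m1 m1r [m0 m0r]]]] := com_ring_zero_one crA.
have [z' [o' [a0' a0r' m1' m1r' [m0' m0r']]]] := com_ring_zero_one crB.
have [h hK Kh] := fgb.
have fE a b : f (h (a, b)) = a by have := Kh (a, b); case.
have gE a b : g (h (a, b)) = b by have := Kh (a, b); case.
rewrite surj_homs_pair cardsU !card_imset; first last.
- move=> u v uv; apply/ffunP=> a.
  have := congr1 (fun w : {ffun _ -> _} => w (h (a, z'))) uv.
  by rewrite !ffunE fE.
- move=> u v uv; apply/ffunP=> a.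
  have := congr1 (fun w : {ffun _ -> _} => w (h (z, a))) uv.
  by rewrite !ffunE gE.
rewrite (_ : _ :&: _ = set0) ?cards0 ?subn0 //; apply/setP=> x; rewrite in_set0.
apply/negP=> /setIP[/imsetP[u /surj_homP[uh us] ->]].
case/imsetP=> v /surj_homP[vh vs].
move/(congr1 (fun w : {ffun _ -> _} => w (h (o, z')))); rewrite !ffunE fE gE.
rewrite (ring_hom_zero vh a0') => uo; have [a ua] := us 1.
have := oner_neq0 K; rewrite -ua -[a]m1r; case: uh => _ ->.
by rewrite uo mulr0 eqxx.
Qed.
End PairHoms.

Lemma split_card_gt0 (T : finType) (add mul : T -> T -> T) :
  split_ring add mul -> 0 < #|T|.
Proof. by case/split_is_com_ring=> z _; apply/card_gt0P; exists z. Qed.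

Lemma surj_homs_singleton (T : finType) (add mul : T -> T -> T)
    (K : finFieldType) : #|T| = 1 -> surj_homs add mul K = set0.
Proof.
move=> T1; apply/eqP; rewrite -subset0; apply/subsetP=> x /surj_homP[_ xs].
have [[a xa] [b xb]] := (xs 0%R, xs 1%R).
have /fintype1P[z zE] : #|T| == 1 by apply/eqP.
by have := oner_neq0 K; rewrite -xa -xb (zE a) (zE b) eqxx.
Qed.

(** Both sides turn a product of rings into a sum. The bound [v] is independent of [T], so the
    induction hypothesis applies to the smaller factor. *)
Lemma sum_surj_homs p v (K : nat -> finFieldType) (T : finType)
    (add mul : T -> T -> T) :
  prime p -> (forall k, #|K k| = p ^ k.+1) -> split_ring add mul ->
  logn p #|T| <= v ->
  \sum_(k < v) #|surj_homs add mul (K k)| = logn p #|T|.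
Proof.
move=> pr_p oK; elim=> [{}T {}add {}mul T1 _|].
  by rewrite T1 logn1 big1 // => k _; rewrite surj_homs_singleton ?cards0.
move=> F T' add' mul' {}T {}add {}mul f g sT' IH fh gh fgb.
have T'0 := split_card_gt0 sT'.
rewrite (bij_eq_card fgb) card_prod lognM //; last first.
  exact: ltnW (finNzRing_gt1 F).
move=> le_v.
have [crF crT'] := (field_is_com_ring F, split_is_com_ring sT').
under eq_bigr => k _ do rewrite (card_surj_homs_pair crF crT' fh gh fgb).
rewrite big_split /= (sum_surj_homs_field pr_p oK) ?IH //.
  exact: leq_trans (leq_addl _ _) le_v.
exact: leq_trans (leq_addr _ _) le_v.
Qed.

(** * Existence and uniqueness of the complement of a surjection onto a field *)

Lemma surj_hom_complement (K : finFieldType) (T : finType)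
    (add mul : T -> T -> T) (x : {ffun T -> K}) :
  split_ring add mul -> x \in surj_homs add mul K ->
  exists (U : finType) (addU mulU : U -> U -> U) (y : T -> U),
    [/\ split_ring addU mulU, ring_hom add mul addU mulU y
      & bijective (fun a => (x a, y a))].
Proof.
move=> sT; elim: sT x => [{}T {}add {}mul T1 x|].
  by rewrite surj_homs_singleton ?in_set0.
move=> F T' add' mul' {}T {}add {}mul f g sT' IH fh gh fgb x.
have [h hK Kh] := fgb; have [fD fM] := fh; have [gD gM] := gh.
have [crF crT'] := (field_is_com_ring F, split_is_com_ring sT').
rewrite (surj_homs_pair crF crT' fh gh fgb).
case/setUP=> /imsetP[u uS ->].
  (* The homomorphism comes from the factor [F]: then [F] is isomorphic to [K], with inverse [v],
     and [T'] is the complement. *)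
  have [w uw] := surj_hom_fieldE uS; have [_ us] := surj_homP _ _ _ uS.
  have /fin_all_exists[v uv] := us.
  exists T', add', mul', g; split=> //.
  exists (fun y => h (v y.1, y.2)) => [a|[a b]] /=; rewrite ?ffunE.
    rewrite -[RHS]hK; congr (h (_, _)).
    by apply: (fmorph_inj w); rewrite -!uw uv.
  have [-> ->] := Kh (v a, b); by rewrite uv.
(* It comes from [T']: a complement [U] inside [T'] gives the complement [F * U]. *)
have [U [addU [mulU [y [sU [yD yM] [s sK Ks]]]]]] := IH u uS.
exists (F * U)%type, (fun a b => (a.1 + b.1, addU a.2 b.2)%R).
exists (fun a b => (a.1 * b.1, mulU a.2 b.2)%R).
exists (fun a => (f a, y (g a))); split.
- apply: (split_cons (f := fst) (g := snd) sU) => //.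
  by exists id; case.
- by split=> a b /=; rewrite ?fD ?gD ?yD ?fM ?gM ?yM.
- exists (fun c => h (c.2.1, s (c.1, c.2.2))) => [a|[a [b c]]] /=.
    by rewrite ffunE sK hK.
  have [e1 e2] := Kh (b, s (a, c)); have [e3 e4] := Ks (a, c).
  by rewrite ffunE e1 e2 e3 e4.
Qed.

(* The kernel {0} x A of the first projection has unit (0, 1), so h (0, 1) is
   (0, 1), and multiplying by it shows that the second component of h (x, y)
   does not depend on x. *)
Lemma pair_hom_over (K : fieldType) (A B : Type) (addA mulA : A -> A -> A)
    (addB mulB : B -> B -> B) (h : K * A -> K * B) :
  is_com_ring addA mulA -> is_com_ring addB mulB ->
  (forall u, (h u).1 = u.1) -> (forall b, exists u, h u = (0%R, b)) ->
  {morph h : u v / (u.1 * v.1, mulA u.2 v.2)%R >->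
                   (u.1 * v.1, mulB u.2 v.2)%R} ->
  forall x y, h (x, y) = (x, (h (0%R, y)).2).
Proof.
move=> /com_ring_zero_one[z [o [_ _ _ m1 _]]].
move=> /com_ring_zero_one[z' [o' [_ _ m1' m1r' _]]].
move=> h1 hs hM.
have ho : (h (0%R, o)).2 = o'.
  have [[x y] xy] := hs o'; have x0 : x = 0%R by have := h1 (x, y); rewrite xy.
  rewrite x0 in xy.
  have := hM (0%R, y) (0%R, o); rewrite /= m1 mulr0 xy => /(congr1 snd) /=.
  by rewrite m1'.
move=> x y; have := hM (x, y) (0%R, o); rewrite /= m1 mulr0 ho m1r'.
move=> -> /=; by rewrite [LHS]surjective_pairing h1.
Qed.

(** * Double counting of structures marked by a surjection onto a field *)

Section Marked.
Variables (K : finFieldType) (n m : nat).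
Hypotheses (nE : n = #|K| * m) (m_gt0 : 0 < m).

Let marked : {set ring_data n * {ffun 'I_n -> K}} :=
  [set y : ring_data n * {ffun 'I_n -> K} | (y.1 \in riemann_species n) &&
           (y.2 \in surj_homs (fun a b => y.1.1 a b) (fun a b => y.1.2 a b) K)].

Let coords : {set {ffun 'I_n -> K * 'I_m} * ring_data m} :=
  [set x : {ffun 'I_n -> K * 'I_m} * ring_data m |
    injectiveb x.1 && (x.2 \in riemann_species m)].

(** The incidence relation of the double count: an element of [coords] meets one element of
    [marked], and an element of [marked] meets m! elements of [coords]. *)
Let compatible (x : {ffun 'I_n -> K * 'I_m} * ring_data m)
    (y : ring_data n * {ffun 'I_n -> K}) : bool :=
  `[< (forall i, y.2 i = (x.1 i).1) /\
      ring_hom (fun a b => y.1.1 a b) (fun a b => y.1.2 a b)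
        (fun a b => x.2.1 a b) (fun a b => x.2.2 a b) (fun i => (x.1 i).2)>].

Let in_marked (d : ring_data n) (x : {ffun 'I_n -> K}) : reflect
  (split_ring (fun a b => d.1 a b) (fun a b => d.2 a b) /\
   x \in surj_homs (fun a b => d.1 a b) (fun a b => d.2 a b) K)
  ((d, x) \in marked).
Proof.
rewrite [_ \in marked]in_set /=; apply: (iffP andP) => -[].
  by move/riemann_speciesP.
by move=> sd xS; split=> //; apply/riemann_speciesP.
Qed.

Let in_coords (f : {ffun 'I_n -> K * 'I_m}) (d : ring_data m) : reflect
  (injective f /\ split_ring (fun a b => d.1 a b) (fun a b => d.2 a b))
  ((f, d) \in coords).
Proof.
rewrite [_ \in coords]in_set /=; apply: (iffP andP) => -[].
  by move=> /injectiveP fI /riemann_speciesP.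
by move=> fI sd; split; [apply/injectiveP | apply/riemann_speciesP].
Qed.

Let coords_bij (f : {ffun 'I_n -> K * 'I_m}) : injective f -> bijective f.
Proof. by move=> fI; apply: inj_card_bij; rewrite // card_prod !card_ord nE. Qed.

Let coords_marked x : x \in coords -> #|[set y in marked | compatible x y]| = 1.
Proof.
case: x => f d' /in_coords[/coords_bij[h hK Kh] sd'].
(* The structure of the product of [K] and ['I_m], pulled back along [f]; compatibility leaves no
   other choice. *)
pose d : ring_data n :=
  ([ffun a => [ffun b => h ((f a).1 + (f b).1, d'.1 (f a).2 (f b).2)%R]],
   [ffun a => [ffun b => h ((f a).1 * (f b).1, d'.2 (f a).2 (f b).2)%R]]).
pose x : {ffun 'I_n -> K} := [ffun i => (f i).1].
have xh : ring_hom (fun a b => d.1 a b) (fun a b => d.2 a b) +%R *%R x.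
  by split=> a b; rewrite !ffunE Kh.
have yh : ring_hom (fun a b => d.1 a b) (fun a b => d.2 a b)
     (fun a b => d'.1 a b) (fun a b => d'.2 a b) (fun i => (f i).2).
  by split=> a b; rewrite !ffunE Kh.
apply/eqP/cards1P; exists (d, x); apply/setP=> -[e u]; rewrite in_set1.
apply/setIdP/eqP.
  case=> /in_marked[_ /surj_homP[[uD uM] _]] /asboolP[/= uf [yD yM]].
  have -> : u = x by apply/ffunP=> i; rewrite ffunE uf.
  have -> : e = d.
    rewrite [e]surjective_pairing; congr (_, _);
      apply/ffunP=> a; apply/ffunP=> b; rewrite !ffunE;
      apply: (can_inj hK); rewrite Kh [LHS]surjective_pairing.
      by rewrite yD -uf uD !uf.
    by rewrite yM -uf uM !uf.
  by [].
case=> -> ->; split; last by apply/asboolP; split=> // i; rewrite ffunE.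
apply/in_marked; split.
  apply: (split_cons (f := x) (g := fun i => (f i).2) sd') => //.
  by exists h => [a|u']; rewrite ?ffunE -?surjective_pairing.
apply/surj_homP; split=> // z; exists (h (z, Ordinal m_gt0)).
by rewrite ffunE Kh.
Qed.

(** Fix a complement [U] of the mark x, with projection y. The compatible bijections are exactly the
    maps sending i to (x i, t (y i)) with t a bijection from [U] to ['I_m], and each of them
    determines the structure on ['I_m]. *)
Let marked_coords y : y \in marked -> #|[set x in coords | compatible x y]| = m`!.
Proof.
case: y => d x /in_marked[sd xS].
have [U [addU [mulU [y [sU [yD yM] [h hK Kh]]]]]] := surj_hom_complement sd xS.
have /surj_homP[[xD xM] _] := xS.
have xE a b : x (h (a, b)) = a by have := Kh (a, b); case.
have yE a b : y (h (a, b)) = b by have := Kh (a, b); case.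
have oU : #|U| = m.
  have := bij_eq_card (Bijective hK Kh).
  rewrite card_prod card_ord nE => /eqP; rewrite eqn_pmul2l => [/eqP//|].
  exact: ltnW (finNzRing_gt1 K).
pose F (t : {ffun U -> 'I_m}) : {ffun 'I_n -> K * 'I_m} :=
  [ffun i => (x i, t (y i))].
have FI : injective F.
  move=> s t /ffunP st; apply/ffunP=> u; have := st (h (0%R, u)).
  by rewrite !ffunE yE; case.
have -> : m`! = #|F @: [set t : {ffun U -> 'I_m} | injectiveb t]|.
  by rewrite card_imset // card_inj_ffuns card_ord oU ffactnn.
(* The second component of a bijection [f] is onto ['I_m], so at most one structure there makes it a
   homomorphism. *)
rewrite -(card_in_imset (f := fst)); last first.
  move=> [f d1] [f' d2] /setIdP[/in_coords[/coords_bij[k kK Kk] _]].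
  move=> /asboolP[/= _ [D1 M1]] /setIdP[_ /asboolP[/= _ [D2 M2]]] ff'.
  rewrite -ff' in D2 M2 *; congr (_, _).
  have sE a : a = (f (k (0%R, a))).2 by rewrite Kk.
  rewrite [d1]surjective_pairing [d2]surjective_pairing; congr (_, _);
    apply/ffunP=> a; apply/ffunP=> b; rewrite [a]sE [b]sE.
    by rewrite -D1 -D2.
  by rewrite -M1 -M2.
apply: eq_card => f; apply/imsetP/imsetP.
  move=> [[f' d']] /setIdP[/in_coords[fI sd']] /asboolP[/= xf [fD fM]] ->.
  have [k kK Kk] := coords_bij fI.
  (* Applied to [f' \o h], a map over [K], this makes the second coordinate of [f'] depend on the
     [U]-coordinate alone, which yields [t]. *)
  have hom := @pair_hom_over K U 'I_m addU mulU
    (fun a b => d'.1 a b) (fun a b => d'.2 a b) (f' \o h)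
    (split_is_com_ring sU) (split_is_com_ring sd').
  have {hom} E : forall a b, f' (h (a, b)) = (a, (f' (h (0%R, b))).2).
    apply: hom => [[a b]|b|[a b] [a' b']] /=.
    - by rewrite -xf xE.
    - by exists (x (k (0%R, b)), y (k (0%R, b))); rewrite hK Kk.
    - have -> : h (a * a', mulU b b')%R = d.2 (h (a, b)) (h (a', b')).
        by rewrite -[RHS]hK xM yM !xE !yE.
      by rewrite [LHS]surjective_pairing -xf xM fM !xf.
  exists [ffun u => (f' (h (0%R, u))).2].
    rewrite in_set; apply/injectiveP=> u v; rewrite !ffunE => uv.
    have /fI/(can_inj Kh) : f' (h (0%R, u)) = f' (h (0%R, v)).
      by rewrite E uv -E.
    by case.
  by apply/ffunP=> i; rewrite !ffunE -E hK.
move=> [t]; rewrite in_set => /injectiveP tI ->.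
have [s sK Ks] : bijective t by apply: inj_card_bij; rewrite // oU card_ord.
(* Conversely, a bijection [t] carries the structure of [U] over to ['I_m]. *)
pose d' : ring_data m :=
  ([ffun a => [ffun b => t (addU (s a) (s b))]],
   [ffun a => [ffun b => t (mulU (s a) (s b))]]).
exists (F t, d') => //; apply/setIdP; split; last first.
  apply/asboolP; split=> [i|] /=; first by rewrite ffunE.
  by split=> a b; rewrite !ffunE /= ?yD ?yM !sK.
apply/in_coords; split.
  move=> a b; rewrite !ffunE; case=> xab /tI yab.
  by apply: (can_inj hK); rewrite /= xab yab.
apply: (split_ring_iso (h := s)) sU; first by exists t.
by split=> a b; rewrite !ffunE sK.
Qed.

Lemma card_marked_species :
  (\sum_(d in riemann_species n)
     #|surj_homs (fun a b => d.1 a b) (fun a b => d.2 a b) K|) * m`! =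
  n`! * #|riemann_species m|.
Proof.
have -> : n`! * #|riemann_species m| = #|coords|.
  rewrite (_ : coords = 
      setX [set f : {ffun 'I_n -> K * 'I_m} | injectiveb f] (riemann_species m)).
    by rewrite cardsX card_inj_ffuns card_prod !card_ord -nE ffactnn.
  by apply/setP=> -[f d]; rewrite in_setX !in_set.
have -> : \sum_(d in riemann_species n)
     #|surj_homs (fun a b => d.1 a b) (fun a b => d.2 a b) K| = #|marked|.
  under eq_bigr do rewrite -sum1_card.
  rewrite pair_big_dep /= -sum1_card; apply: eq_bigl => -[d x].
  by rewrite [RHS]in_set.
(* Both sides become the number of compatible pairs, summed over [marked] on the left and over
   [coords] on the right. *)
rewrite -sum_nat_const -[RHS]muln1 -sum_nat_const.
under eq_bigr => y yM do rewrite -(marked_coords yM) -sum1_card.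
under [RHS]eq_bigr => x xC do rewrite -(coords_marked xC) -sum1_card.
rewrite (exchange_big_dep (mem coords)) /=; last first.
  by move=> y x _; case/setIdP.
apply: eq_bigr => x xC; apply: eq_bigl => y.
apply/andP/setIdP => -[yM]; first by case/setIdP.
by move=> c; split=> //; apply/setIdP.
Qed.
End Marked.

(** * The count of structures, by strong induction *)

Unset Implicit Arguments.

Theorem theorem3p10 (n : nat) : 0 < n -> #|riemann_species n| = n`!.
Proof.
have [k] := ubnP n; elim: k n => // k IHk n; rewrite ltnS => nk n_gt0.
have [n1|n_gt1] := leqP n 1.
  have {n1 n_gt0 nk} -> : n = 1 by apply/eqP; rewrite eqn_leq n1.
  (* On one point there is a single pair of operations, and it gives the empty product of fields. *)
  rewrite -[1`!](_ : #|ring_data 1| = 1); last first.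
    by rewrite card_prod !card_ffun !card_ord !exp1n.
  rewrite -cardsT; congr #|pred_of_set _|; apply/setP=> d; rewrite in_setT.
  by apply/riemann_speciesP/split_one; rewrite card_ord.
set p := pdiv n; have pr_p : prime p := pdiv_prime n_gt1.
have ex_field j : exists K : finFieldType, #|K| = p ^ j.+1.
  by have [K _ oK] := pPrimePowerField pr_p (ltn0Sn j); exists K.
have [K oK] : exists K : nat -> finFieldType, forall j, #|K j| = p ^ j.+1.
  by exists (fun j => projT1 (cid (ex_field j))) => j; case: cid.
have v_gt0 : 0 < logn p n by rewrite logn_gt0 mem_primes pr_p n_gt0 pdiv_dvd.
(* The equation is proved after multiplication by the positive valuation [logn p n], which on the
   left counts homomorphisms structure by structure. *)
apply/eqP; rewrite -(eqn_pmul2r v_gt0); apply/eqP.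
transitivity (\sum_(d in riemann_species n) \sum_(j < logn p n)
    #|surj_homs (fun a b => d.1 a b) (fun a b => d.2 a b) (K j)|).
  rewrite -sum_nat_const; apply: eq_bigr => d /riemann_speciesP sd.
  by rewrite (sum_surj_homs pr_p oK sd) card_ord.
rewrite exchange_big /= mulnC -[logn p n in RHS]card_ord -sum_nat_const.
apply: eq_bigr => j _; have dvd_n : p ^ j.+1 %| n by rewrite pfactor_dvdn.
have m_gt0 : 0 < n %/ p ^ j.+1.
  by rewrite divn_gt0 ?expn_gt0 ?prime_gt0 // dvdn_leq.
have nE : n = #|K j| * (n %/ p ^ j.+1) by rewrite oK mulnC divnK.
(* Here m = n / p^(j+1) is less than n, so the induction hypothesis gives m! structures, and m!
   cancels. *)
have := card_marked_species nE m_gt0; rewrite IHk //; last first.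
  apply: leq_trans nk; rewrite ltn_Pdiv // -[1]/(p ^ 0) ltn_exp2l ?prime_gt1 //.
by move/eqP; rewrite eqn_pmul2r ?fact_gt0 // => /eqP.
Qed.
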